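(* Let $R$ be a commutative ring with identity and let $M$ be a faithful finitely generated coreduced comultiplication $R$-module. Then for each $a\in R$, $\mathrm{Ann}_R(aM)M=\mathfrak{S}_{(0:_M a)}$.
   Context: For a submodule $N$ of $M$, $r\in R$ and an ideal $I$ of $R$: $(N:_M I)=\{m\in M: Im\subseteq N\}$, $(N:_M r)=\{m\in M: rm\in N\}$. $M$ is a comultiplication module if for every submodule $N$ of $M$ there is an ideal $I$ of $R$ with $N=(0:_M I)$. A proper submodule $N$ of $M$ is completely irreducible if $N=\bigcap_{i\in I}N_i$, for a family $\{N_i\}_{i\in I}$ of submodules of $M$, implies $N=N_i$ for some $i$. $M$ is coreduced if for every $r\in R$ and every completely irreducible submodule $L$ of $M$, $(L:_M r)=M$ implies $L+(0:_M r)=M$. A non-zero submodule $N$ of $M$ is second if for each $a\in R$ the multiplication map $N\xrightarrow{a}N$ is either surjective or zero. A second submodule $N$ of $M$ is a maximal second submodule of $M$ if there is no second submodule $L$ of $M$ with $N\subsetneq L\subseteq M$. For a submodule $K$ of $M$, $\mathfrak{S}_K$ is the sum of all maximal second submodules of $M$ contained in $K$ (zero if there are none). *)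

(* Defs.v *)
From HB Require Import structures.
From mathcomp Require Import all_boot all_algebra.
From mathcomp Require Import boolp classical_sets functions.

Set Implicit Arguments.
Unset Strict Implicit.
Unset Printing Implicit Defensive.

Import GRing.Theory.

Local Open Scope classical_set_scope.
Local Open Scope ring_scope.

Definition submodule (R : pzRingType) (M : lmodType R) (N : set M) : Prop :=
  submod_closed [in N].

Lemma submoduleP (R : pzRingType) (M : lmodType R) (N : set M) :
  submodule N <->
  N 0 /\ forall (a : R) (x y : M), N x -> N y -> N (a *: x + y).
Proof.
split=> -[N0 NL]; split.
- by move: N0; rewrite inE.
- by move=> a x y Nx Ny; have := NL a x y; rewrite !inE; apply.
- by rewrite inE.
- by move=> a x y; rewrite !inE; apply: NL.
Qed.

(* [idealr_closed] additionally excludes the unit ideal, hence the use of the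
   submodules of the regular module. *)
Definition ideal (R : comPzRingType) (I : set R) : Prop :=
  submodule (I : set R^o).

Definition ann (R : comPzRingType) (M : lmodType R) (N : set M) : set R :=
  [set r | forall x, N x -> r *: x = 0].

Definition colon (R : comPzRingType) (M : lmodType R) (N : set M) (r : R) :
    set M :=
  [set m | N (r *: m)].

Definition colon_ideal (R : comPzRingType) (M : lmodType R) (N : set M)
    (I : set R) : set M :=
  [set m | forall r, I r -> N (r *: m)].

Definition scale_set (R : comPzRingType) (M : lmodType R) (a : R) (N : set M) :
    set M :=
  [set a *: m | m in N].

Definition add_set (R : comPzRingType) (M : lmodType R) (N L : set M) : set M :=
  [set x + y | x in N & y in L].

Definition span_set (R : comPzRingType) (M : lmodType R) (X : set M) : set M :=
  smallest (@submodule R M) X.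

Definition ideal_mul (R : comPzRingType) (M : lmodType R) (I : set R)
    (N : set M) : set M :=
  span_set [set r *: m | r in I & m in N].

(* The sum of the empty family is the zero submodule. *)
Definition sum_submodules (R : comPzRingType) (M : lmodType R)
    (F : set (set M)) : set M :=
  span_set (\bigcup_(N in F) N).

Definition finitely_generated (R : comPzRingType) (M : lmodType R) : Prop :=
  exists s : seq M, span_set [set` s] = [set: M].

Definition faithful_module (R : comPzRingType) (M : lmodType R) : Prop :=
  ann [set: M] = [set 0].

Definition comultiplication_module (R : comPzRingType) (M : lmodType R) :
    Prop :=
  forall N : set M, submodule N ->
  exists I : set R, ideal I /\ N = colon_ideal [set 0] I.

Definition completely_irreducible (R : comPzRingType) (M : lmodType R)
    (N : set M) : Prop :=
  [/\ submodule N, N <> [set: M] &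
      forall (I : Type) (F : I -> set M), (forall i, submodule (F i)) ->
      N = \bigcap_i F i -> exists i, N = F i].

Definition coreduced (R : comPzRingType) (M : lmodType R) : Prop :=
  forall (r : R) (L : set M), completely_irreducible L ->
  colon L r = [set: M] -> add_set L (colon [set 0] r) = [set: M].

Definition second_submodule (R : comPzRingType) (M : lmodType R) (N : set M) :
    Prop :=
  [/\ submodule N, N <> [set 0] &
      forall a : R, set_surj N N ( *:%R a) \/ forall x, N x -> a *: x = 0].

Definition maximal_second_submodule (R : comPzRingType) (M : lmodType R)
    (N : set M) : Prop :=
  second_submodule N /\ ~ exists L : set M, second_submodule L /\ N `<` L.

Definition max_second_sum (R : comPzRingType) (M : lmodType R) (K : set M) :
    set M :=
  sum_submodules [set N | maximal_second_submodule N /\ N `<=` K].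

(* Main.v *)
Require Import Defs.
From HB Require Import structures.
From mathcomp Require Import all_boot all_algebra.
From mathcomp Require Import boolp classical_sets functions.
From mathcomp Require Import ring.

Set Implicit Arguments.
Unset Strict Implicit.
Unset Printing Implicit Defensive.

Import GRing.Theory.

Local Open Scope classical_set_scope.
Local Open Scope ring_scope.

(** The two sides agree because both are equal to [(0 :_M a)]; each is clearly
    contained in it, so the point is the reverse inclusions.

    Call [c] an atom when [R c] is a simple [R]-module, and suppose [a z = 0].
    For an atom [c], either [a c = 0], or [c] is a multiple of [a c] and so
    [c z = 0]. If the atoms generate the unit ideal, then [z = 1 z] lies in the
    sum of the [c M] over the atoms [c] with [a c = 0] ([colon0_sub]). Such a
    [c M] lies in [Ann(aM) M] since [c] kills [a M], and in the sum of the
    maximal second submodules since it is one of them ([atom_maximal_second]).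

    The atoms generate the unit ideal ([atoms_generate]) because no maximal
    ideal [m] contains them all. Indeed [m M] is proper by Nakayama's lemma
    ([nakayama]), as [M] is finitely generated and faithful. Since [M] is a
    comultiplication module, [m M] is the annihilator in [M] of some ideal; that
    ideal is non-zero and kills [m], hence contains a [c <> 0] with
    [Ann(c) = m], an atom. Finally [c] is not in [m], for otherwise [c ^ 2 = 0],
    while coreducedness and faithfulness make [R] reduced
    ([coreduced_reduced]). *)

(** * Submodules and spans *)

Section Submodules.
Variables (R : comPzRingType) (M : lmodType R).
Implicit Types (N L : set M) (X : set M).

Lemma submodule_0 N : submodule N -> N 0.
Proof. by case/submoduleP. Qed.

Lemma submoduleZ N a x : submodule N -> N x -> N (a *: x).
Proof. by case/submoduleP=> N0 NL Nx; rewrite -[_ *: _]addr0; apply: NL. Qed.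

Lemma submoduleD N x y : submodule N -> N x -> N y -> N (x + y).
Proof. by case/submoduleP=> _ NL Nx Ny; rewrite -[x]scale1r; apply: NL. Qed.

Lemma submodule_span X : submodule (span_set X).
Proof.
apply/submoduleP; split=> [N [/submodule_0]//|a x y Xx Xy N [smN XN]].
by apply: submoduleD; [|apply: submoduleZ => //; apply: Xx|apply: Xy].
Qed.

Lemma submodule_preimage N a : submodule N -> submodule (colon N a).
Proof.
move=> smN; apply/submoduleP; split=> [|b x y Nx Ny]; rewrite /colon /=.
  by rewrite scaler0; apply: submodule_0.
rewrite scalerDr scalerA mulrC -scalerA.
by apply: submoduleD => //; apply: submoduleZ.
Qed.

Lemma submodule_set0 : submodule [set (0 : M)].
Proof.
by apply/submoduleP; split=> // b x y /= -> ->; rewrite scaler0 addr0.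
Qed.

Lemma submodule_scale_set N a : submodule N -> submodule (scale_set a N).
Proof.
move=> smN; apply/submoduleP; split=> [|b _ _ [x Nx <-] [y Ny <-]].
  by exists 0; [exact: submodule_0|rewrite scaler0].
exists (b *: x + y); first by apply: submoduleD => //; apply: submoduleZ.
by rewrite scalerDr !scalerA mulrC.
Qed.

(** Zorn's lemma in the only form used here: with [x = 1] in the regular module
    it gives maximal ideals, and in [M] it gives completely irreducible
    submodules. *)
Lemma maximal_submodule_avoiding N x : submodule N -> ~ N x ->
  exists L, [/\ submodule L, N `<=` L, ~ L x &
    forall K, submodule K -> L `<=` K -> ~ K x -> K = L].
Proof.
move=> smN Nx.
(* The guard admits the empty set, the union of the empty chain. *)
pose P (A : set M) := A !=set0 -> [/\ submodule A, N `<=` A & ~ A x].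
have [F FP Ftot|L [PL Lmax]] := @Zorn_bigcup _ P.
  case=> w [X0 FX0 X0w].
  have [smX0 NX0 _] := FP _ FX0 (ex_intro _ w X0w).
  split=> [||[X FX Xx]]; last first.
  - by have [_ _] := FP _ FX (ex_intro _ x Xx); apply.
  - by move=> y Ny; exists X0 => //; apply: NX0.
  apply/submoduleP; split; first by exists X0 => //; apply: submodule_0.
  move=> b u v [X FX Xu] [Y FY Yv].
  have [smX _ _] := FP _ FX (ex_intro _ u Xu).
  have [smY _ _] := FP _ FY (ex_intro _ v Yv).
  have [XY|YX] := Ftot _ _ FX FY.
    exists Y => //; apply: submoduleD => //.
    by apply: submoduleZ => //; apply: XY.
  by exists X => //; apply: submoduleD => //; [apply: submoduleZ|apply: YX].
have [L0|Ln0] := eqVneq L set0.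
  have LN : L `<` N.
    rewrite L0 properEneq; split=> //.
    by apply/eqP => N0; have := submodule_0 smN; rewrite -N0.
  by case: (Lmax N LN) => _; split.
have /set0P /PL [smL NL Lx] := Ln0; exists L; split=> // K smK LK Kx.
apply: contrapT => /eqP KL; apply: (Lmax K); first by rewrite properEneq eq_sym.
by move=> _; split=> //; apply: subset_trans LK.
Qed.

Lemma avoiding_completely_irreducible L x : submodule L -> ~ L x ->
  (forall K, submodule K -> L `<=` K -> ~ K x -> K = L) ->
  completely_irreducible L.
Proof.
move=> smL Lx Lmax; split=> // [LT|I F smF LF]; first by apply: Lx; rewrite LT.
have [i Fix] : exists i, ~ F i x.
  by apply/existsNP => Fx; apply: Lx; rewrite LF => i _; apply: Fx.
by exists i; rewrite (Lmax (F i)) // LF => y; apply.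
Qed.

Lemma span_cons x (s : seq M) y :
  span_set [set` x :: s] y ->
  exists (v : R) (z : M), span_set [set` s] z /\ y = z + v *: x.
Proof.
pose T := [set y | exists (v : R) (z : M),
             span_set [set` s] z /\ y = z + v *: x].
have sms := @submodule_span [set` s].
suff [smT sT] : submodule T /\ [set` x :: s] `<=` T.
  by move=> sy; apply: (sy T).
split.
  apply/submoduleP; split.
    by exists 0, 0; rewrite scale0r addr0; split=> //; apply: (submodule_0 sms).
  move=> b _ _ [v [z [sz ->]]] [w [t [st ->]]].
  exists (b * v + w), (b *: z + t); split.
    exact: (submoduleD sms (submoduleZ b sms sz) st).
  by rewrite scalerDr scalerDl scalerA addrACA.
move=> t /=; rewrite inE => /orP[/eqP->|ts].
  by exists 1, 0; rewrite add0r scale1r; split=> //; apply: (submodule_0 sms).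
exists 0, t; rewrite scale0r addr0; split=> //.
by move=> N [_ sN]; apply: sN.
Qed.

End Submodules.

(** * Nakayama's lemma *)

Section Nakayama.
Variables (R : comPzRingType) (M : lmodType R) (I : set R).
Hypotheses (idI : ideal I) (IM : ideal_mul I [set: M] = [set: M]).

(** Multiplying by an element congruent to 1 modulo [I] removes one generator:
    if [d M] is spanned by [x] and [s], then [d x = z + u x] with [u] in [I] and
    [z] in the span of [s], so [d - u] sends [x] into the span of [s]. *)
Lemma nakayama_step x (s : seq M) :
  (exists2 d, I (1 - d) & forall y, span_set [set` x :: s] (d *: y)) ->
  exists2 d, I (1 - d) & forall y, span_set [set` s] (d *: y).
Proof.
case=> d Id dM; have sms := @submodule_span _ M [set` s].
pose T := [set y : M | exists2 u, I u &
             exists2 z, span_set [set` s] z & y = z + u *: x].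
have smT : submodule T.
  apply/submoduleP; split.
    exists 0; first exact: submodule_0 idI.
    by exists 0; [exact: (submodule_0 sms)|rewrite scale0r addr0].
  move=> b _ _ [v Iv [z sz ->]] [w Iw [t st ->]].
  exists (b * v + w).
    by apply: (submoduleD idI) => //; apply: (submoduleZ b idI).
  exists (b *: z + t); first exact: (submoduleD sms (submoduleZ b sms sz) st).
  by rewrite scalerDr scalerDl scalerA addrACA.
have [u Iu [z sz dx]] : T (d *: x).
  suff : ideal_mul I [set: M] `<=` colon T d by apply; rewrite IM.
  apply: smallest_sub; first exact: (submodule_preimage d smT).
  move=> _ [r Ir [m _ <-]].
  have [v [t [st dm]]] := span_cons (dM m).
  exists (v * r); first exact: (submoduleZ v idI).
  exists (r *: t); first exact: (submoduleZ r sms st).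
  by rewrite scalerA [d * r]mulrC -[_ *: m]scalerA dm scalerDr scalerA [r * v]mulrC.
exists ((d - u) * d).
  have -> : 1 - (d - u) * d = (1 + d) * (1 - d) + d * u by ring.
  by apply: (submoduleD idI); [apply: (submoduleZ (1 + d) idI)
                              |apply: (submoduleZ d idI)].
move=> y; have [v [t [st dy]]] := span_cons (dM y).
rewrite -scalerA dy scalerDr scalerA mulrC -scalerA.
apply: (submoduleD sms); first exact: (submoduleZ _ sms st).
by apply: (submoduleZ v sms); rewrite scalerBl dx addrK.
Qed.

Lemma nakayama : finitely_generated M ->
  exists2 d, I (1 - d) & forall y : M, d *: y = 0.
Proof.
case=> s sM.
have : exists2 d, I (1 - d) & forall y, span_set [set` s] (d *: y).
  exists 1; first by rewrite subrr; apply: (submodule_0 idI).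
  by move=> y; rewrite sM.
elim: s {sM} => [|x s IHs]; last by move/nakayama_step.
case=> d Id dM; exists d => // y; apply: (dM y [set 0]).
by split=> //; exact: submodule_set0.
Qed.

End Nakayama.

(** * Atoms of the ring *)

(** The elements [c] for which the principal ideal [R c] is simple. *)
Definition atom (R : comPzRingType) (c : R) : Prop :=
  c <> 0 /\ forall r, r * c = 0 \/ exists s, s * (r * c) = c.

Section Atoms.
Variables (R : comPzRingType) (M : lmodType R).
Hypothesis Mfaithful : faithful_module M.

Lemma faithful_eq0 (r : R) : (forall x : M, r *: x = 0) -> r = 0.
Proof.
by move=> rM; have : ann [set: M] r by []; rewrite Mfaithful.
Qed.

(** If [c ^ 2 = 0] then [c M] lies in [(0 :_M c)]. Were [(0 :_M c)] proper, a
    completely irreducible [L] above it would satisfy [(L :_M c) = M], and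
    coreducedness would give [M = L + (0 :_M c) = L]. *)
Lemma coreduced_reduced (c : R) : coreduced M -> c * c = 0 -> c = 0.
Proof.
move=> Mcored cc0; apply: faithful_eq0 => y; apply: contrapT => cy.
have sm0c := submodule_preimage c (@submodule_set0 _ M).
have [L [smL cL Ly Lmax]] := @maximal_submodule_avoiding _ M _ y sm0c cy.
have irrL := avoiding_completely_irreducible smL Ly Lmax.
have : add_set L (colon [set 0] c) = [set: M].
  apply: Mcored => //; apply/seteqP; split=> // m _.
  by apply: cL; rewrite /colon /= scalerA cc0 scale0r.
move=> LcT; have : [set: M] y by []; rewrite -LcT => -[u Lu [v cv yE]].
by apply: Ly; rewrite -yE; apply: submoduleD => //; apply: cL.
Qed.

(** By Nakayama's lemma and faithfulness [I M <> M]. The comultiplication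
    property writes [I M] as [(0 :_M J)]; then [J] kills [I] by faithfulness,
    and [J] is non-zero because [I M <> M]. *)
Lemma proper_ideal_killed (I : set R) :
  finitely_generated M -> comultiplication_module M -> ideal I -> ~ I 1 ->
  exists2 c, c <> 0 & forall r, I r -> r * c = 0.
Proof.
move=> Mfg Mcomult idI I1; apply: contrapT => noc.
have [J [idJ IMJ]] := Mcomult _ (@submodule_span _ M
  [set r *: m | r in I & m in [set: M]]).
case: I1; have [|d Id dM] := @nakayama _ M I idI _ Mfg; last first.
  by rewrite -[1]subr0 -(faithful_eq0 dM).
apply/seteqP; split=> // x _; rewrite /ideal_mul IMJ => c Jc.
have [->|/eqP c0] := eqVneq c 0; first by rewrite scale0r.
case: noc; exists c => // r Ir; apply: faithful_eq0 => m.
have : ideal_mul I [set: M] (r *: m).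
  by apply: sub_gen_smallest; exists r => //; exists m.
by rewrite /ideal_mul IMJ => /(_ c Jc) /=; rewrite scalerA mulrC.
Qed.

Lemma atoms_generate (J : set R) :
  finitely_generated M -> comultiplication_module M -> coreduced M ->
  ideal J -> (forall c, atom c -> J c) -> J 1.
Proof.
move=> Mfg Mcomult Mcored idJ atJ; apply: contrapT => J1.
have [m [idm Jm m1 mmax]] := @maximal_submodule_avoiding _ R^o J 1 idJ J1.
have [c c0 mc0] := proper_ideal_killed Mfg Mcomult idm m1.
suff atc : atom c.
  by apply: c0; apply: coreduced_reduced => //; apply/mc0/Jm/atJ.
split=> // r; have [|/eqP rc0] := eqVneq (r * c) 0; [by left|right].
(* [r] lies outside [m], so it is invertible modulo [m], which kills [c]. *)
pose K : set R^o := [set x | exists s, m (x - s * r)].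
have smK : submodule K.
  apply/submoduleP; split.
    by exists 0; rewrite mul0r subrr; apply: (submodule_0 idm).
  move=> b x y [s ms] [t mt]; exists (b * s + t).
  have -> : b *: x + y - (b * s + t) * r = b * (x - s * r) + (y - t * r) :> R.
    by rewrite /GRing.scale /=; ring.
  by apply: (submoduleD idm) => //; apply: (submoduleZ b idm).
have mK : m `<=` K by move=> x mx; exists 0; rewrite mul0r subr0.
have Kr : K r by exists 1; rewrite mul1r subrr; apply: (submodule_0 idm).
have [s ms] : K 1.
  by apply: contrapT => K1; apply/rc0/mc0; rewrite -(mmax K).
exists s; have := mc0 _ ms.
by rewrite mulrBl mul1r mulrA => /eqP; rewrite subr_eq0 => /eqP.
Qed.

(** If a second [L] contains [c M] and [r c = 0], then [r L = L] is impossible: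
    it would give [c L = 0] and so [c ^ 2 M = 0]. Hence [L] is killed by
    [Ann(c)], in particular by [1 - s c] where [s c ^ 2 = c], so [L = c L]. *)
Lemma atom_maximal_second (c : R) :
  coreduced M -> atom c -> maximal_second_submodule (scale_set c [set: M]).
Proof.
move=> Mcored [c0 atc]; split.
  split; first by apply: submodule_scale_set; apply/submoduleP.
    move=> cM0; apply: c0; apply: faithful_eq0 => x.
    have : scale_set c [set: M] (c *: x) by exists x.
    by rewrite cM0.
  move=> r; have [rc0|[s src]] := atc r; [right|left].
    by move=> _ [x _ <-]; rewrite scalerA rc0 scale0r.
  move=> _ [x _ <-]; exists (c *: (s *: x)); first by exists (s *: x).
  by rewrite !scalerA -{2}src; congr (_ *: _); ring.
case=> L [[smL L0 secL] [cL]]; apply.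
have cc0 : c * c <> 0 by move/(coreduced_reduced Mcored).
have annL r : r * c = 0 -> forall l, L l -> r *: l = 0.
  move=> rc0; have [rL|//] := secL r; case: cc0; apply: faithful_eq0 => x.
  have [|l _ /= lE] := rL (c *: x); first by apply: cL; exists x.
  by rewrite -scalerA -lE scalerA mulrC rc0 scale0r.
have [//|[s sccE]] := atc c.
have scL : (1 - s * c) * c = 0 by rewrite mulrBl mul1r -mulrA sccE subrr.
move=> l /(annL _ scL); rewrite scalerBl scale1r => /eqP.
by rewrite subr_eq0 => /eqP ->; exists (s *: l) => //; rewrite scalerA mulrC.
Qed.

(** The elements carrying [(0 :_M a)] into [T] form an ideal, which contains
    every atom [c]: either [c] kills [a], or [c] is a multiple of [a c] and
    kills [(0 :_M a)]. *)
Lemma colon0_sub (a : R) (T : set M) :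
  finitely_generated M -> comultiplication_module M -> coreduced M ->
  submodule T ->
  (forall c, atom c -> a * c = 0 -> scale_set c [set: M] `<=` T) ->
  colon [set 0] a `<=` T.
Proof.
move=> Mfg Mcomult Mcored smT atT.
pose J : set R := [set r | forall z : M, a *: z = 0 -> T (r *: z)].
suff J1 : J 1 by move=> z /J1; rewrite scale1r.
apply: atoms_generate => // [|c atc z az0].
  apply/submoduleP; split=> [z _|b x y Jx Jy z az0].
    by rewrite scale0r; apply: submodule_0.
  rewrite scalerDl -scalerA; apply: submoduleD => //; last exact: Jy.
  by apply: submoduleZ => //; apply: Jx.
have [_ /(_ a) [ac0|[s sac]]] := atc; first by apply: (atT c) => //; exists z.
rewrite -sac [a * c]mulrC mulrA -scalerA az0 scaler0.
exact: submodule_0.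
Qed.

End Atoms.

Theorem corollary2p20 (R : comPzRingType) (M : lmodType R)
    (Mfaithful : faithful_module M) (Mfg : finitely_generated M)
    (Mcoreduced : coreduced M) (Mcomult : comultiplication_module M) (a : R) :
  ideal_mul (ann (scale_set a [set: M])) [set: M]
  = max_second_sum (colon [set (0 : M)] a).
Proof.
have sm0a := submodule_preimage a (@submodule_set0 _ M).
transitivity (colon [set (0 : M)] a); apply/seteqP; split.
- apply: smallest_sub => // _ [r ra [m _ <-]]; rewrite /colon /= scalerA.
  by rewrite mulrC -scalerA ra //; exists m.
- apply: (colon0_sub Mfaithful) => // [|c _ ac0 _ [m _ <-]].
    exact: submodule_span.
  apply: sub_gen_smallest; exists c; last by exists m.
  by move=> _ [x _ <-]; rewrite scalerA mulrC ac0 scale0r.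
- apply: (colon0_sub Mfaithful) => // [|c atc ac0 x cMx].
    exact: submodule_span.
  apply: sub_gen_smallest; exists (scale_set c [set: M]) => //; split.
    exact: atom_maximal_second.
  by move=> _ [y _ <-]; rewrite /colon /= scalerA ac0 scale0r.
- by apply: smallest_sub => // x [N [_ N0a] /N0a].
Qed.
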